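(* Let $X\subset\mathbb{R}^n$ and $S\subset X$ be nonempty semi-algebraic sets, let $f_0\colon X\to\mathbb{R}$ be a Lipschitz function (not necessarily semi-algebraic) with $\inf_{x\in S}f_0(x)$ finite, and let $\psi\colon\mathbb{R}^n\to\mathbb{R}_+$ be a semi-algebraic residual function for $S$. Assume that for any sequence of points $x_k$ in $X$ the following properties hold: (A1) if $\psi(x_k)\to0$, then $\mathrm{dist}(x_k,S)\to0$; (A2) if $\mathrm{dist}(x_k,S)\to\infty$, then $\psi(x_k)\to\infty$. Then there exist constants $c_*>0$, $\alpha>0$ and $\beta>0$ with $\alpha\le1\le\beta$ such that for all $c>c_*$, $$\inf_{x\in S}f_0(x)=\inf_{x\in X}\left\{f_0(x)+c\big([\psi(x)]^\alpha+[\psi(x)]^\beta\big)\right\},$$ $$\mathrm{argmin}_S f_0(x)=\mathrm{argmin}_X\left\{f_0(x)+c\big([\psi(x)]^\alpha+[\psi(x)]^\beta\big)\right\}.$$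
   Context: $\mathbb{R}_+ := [0,\infty)$; $\mathrm{dist}(x,S):=\inf_{x'\in S}\|x-x'\|$ with the Euclidean norm. A subset of $\mathbb{R}^n$ is semi-algebraic if it is a finite union of sets each defined by finitely many polynomial equations and strict inequalities; a function is semi-algebraic if its graph is semi-algebraic. A residual function of $S$ is a function $\psi\colon\mathbb{R}^n\to\mathbb{R}_+$ such that $\psi(x)=0$ if and only if $x\in S$. $f_0$ is Lipschitz on $X$ if there is $L>0$ with $|f_0(x)-f_0(x')|\le L\|x-x'\|$ for all $x,x'\in X$. $\mathrm{argmin}$ denotes the set of points of the indicated set at which the (finite) infimum is attained (possibly empty). *)

(* Defs.v *)
From HB Require Import structures.
From mathcomp Require Import all_boot all_order all_algebra.
From mathcomp Require Import all_classical all_reals all_analysis.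
(* The notations of mpoly clash with those of MathComp-Analysis. *)
From mathcomp Require Import -(notations) mpoly.

Set Implicit Arguments.
Unset Strict Implicit.
Unset Printing Implicit Defensive.

Import Order.TTheory GRing.Theory Num.Theory.
Import numFieldNormedType.Exports.

Local Open Scope classical_set_scope.
Local Open Scope ring_scope.

(* The library norm on row vectors is the sup norm. *)
Definition enorm (R : realType) (n : nat) (x : 'rV[R]_n) : R :=
  Num.sqrt (\sum_(i < n) x 0 i ^+ 2).

(* Only meaningful for a nonempty set: by convention [inf set0 = 0]. *)
Definition dist (R : realType) (n : nat) (x : 'rV[R]_n) (S : set 'rV[R]_n) : R :=
  inf [set enorm (x - y) | y in S].

Definition peval (R : realType) (n : nat) (p : mpoly n R) (x : 'rV[R]_n) : R :=
  meval (fun i => x 0 i) p.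

(* The first sequence lists the equations, the second the strict inequalities. *)
Definition basic_semialgebraic (R : realType) (n : nat)
    (b : seq (mpoly n R) * seq (mpoly n R)) : set 'rV[R]_n :=
  [set x | (forall p : mpoly n R, p \in b.1 -> peval p x = 0) /\
           (forall q : mpoly n R, q \in b.2 -> 0 < peval q x)].

Definition semialgebraic (R : realType) (n : nat) (A : set 'rV[R]_n) : Prop :=
  exists l : seq (seq (mpoly n R) * seq (mpoly n R)),
    A = [set x | exists2 b, b \in l & basic_semialgebraic b x].

(* The graph, as a subset of R^(n+1) with the value as last coordinate. *)
Definition graph (R : realType) (n : nat) (f : 'rV[R]_n -> R) : set 'rV[R]_(n + 1) :=
  [set row_mx x (f x)%:M | x in setT].

Definition semialgebraic_fun (R : realType) (n : nat) (f : 'rV[R]_n -> R) : Prop :=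
  semialgebraic (graph f).

Definition residual (R : realType) (n : nat) (S : set 'rV[R]_n)
    (psi : 'rV[R]_n -> R) : Prop :=
  (forall x, 0 <= psi x) /\ (forall x, psi x = 0 <-> S x).

(* A function on [X] is encoded as a total function whose values outside [X]
   are never used.  The library [lipschitz_on] refers to the sup norm. *)
Definition elipschitz_on (R : realType) (n : nat) (X : set 'rV[R]_n)
    (f : 'rV[R]_n -> R) : Prop :=
  exists2 L : R, 0 < L &
    forall x x', X x -> X x' -> `|f x - f x'| <= L * enorm (x - x').

(* Extended-real, so that an infimum which is not finite is not sent to 0. *)
Definition inf_over (R : realType) (n : nat) (A : set 'rV[R]_n)
    (f : 'rV[R]_n -> R) : \bar R :=
  ereal_inf [set (f x)%:E | x in A].

Definition argmin (R : realType) (n : nat) (A : set 'rV[R]_n)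
    (f : 'rV[R]_n -> R) : set 'rV[R]_n :=
  [set x | A x /\ (f x)%:E = inf_over A f].

(* Main.v *)
Require Import Defs.
From HB Require Import structures.
From mathcomp Require Import all_boot all_order all_algebra.
From mathcomp Require Import all_classical all_reals all_analysis.
From mathcomp Require Import -(notations) mpoly.
From mathcomp Require ordered_qelim qe_rcf polyrcf.
From mathcomp Require Import ring lra.
Import Order.TTheory GRing.Theory Num.Theory.
Import numFieldNormedType.Exports.
Local Open Scope classical_set_scope.
Local Open Scope ring_scope.
Set Implicit Arguments.
Unset Strict Implicit.
Unset Printing Implicit Defensive.

(** The penalty is exact because of an error bound: on [X], the distance to [S]
    is at most [C * (psi x `^ a + psi x `^ b)] with [0 < a <= 1 <= b].  Once
    this is known, a function [f0] which is [L]-Lipschitz on [X] satisfies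
    [inf_S f0 <= f0 x + L * dist x S <= f0 x + L * C * (psi x `^ a + psi x `^ b)],
    and a penalty factor [c > L * C] makes the last quantity strictly smaller
    than the penalised objective wherever [psi x > 0], that is, off [S]; on [S]
    the penalty vanishes ([exact_penalty]).

    The error bound comes from the geometry of the plane set [D] of the pairs
    [(t, d)] such that some [x] in [X] has [psi x = t] and lies at distance at
    least [d] from [S].  [D] is described by a first-order formula over the real
    closed field [R] ([definable_residual_dist]), so that by quantifier
    elimination it is described by finitely many sign conditions on bivariate
    polynomials.  Away from the zero set of the product [q] of the nonzero ones
    among them, a small vertical move neither enters nor leaves [D]; therefore
    the supremum [s] of the slice [D_t], being a boundary point of this slice,
    satisfies [q(t, s) = 0] ([sup_definable_root]).

    What remains is to bound the zeros of one nonzero polynomial [q].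
    - Near [t = 0], divide [q] by a power of [t] so that [q(0, y)] is a nonzero
      polynomial, say [y^m u(y)] with [u(0) <> 0].  As [q(t, y) - q(0, y) = O(t)],
      a zero with [y] small enough satisfies [y^m = O(t)]
      ([bipoly_root_near0]).  Smallness of [y] is what hypothesis (A1) provides.
    - For [t] large, the Cauchy bound on the roots of [q(t, y)] as a polynomial
      in [y] has coefficients of polynomial growth and a leading coefficient
      bounded away from [0], hence [y = O(t^k)] ([bipoly_root_infty]).
    - In between, (A2) bounds the distance on every sublevel set of [psi].
    These three regimes are glued in [definable_powR_bound]. *)

Module ord := ordered_qelim.ord.

(** * First-order definable predicates and semialgebraic sets *)

Section Definability.
Variable R : realType.
Implicit Types (g h : (nat -> R) -> R) (P Q : (nat -> R) -> Prop).

(** Formulas are evaluated on sequences of values, padded with zeros; reading a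
    sequence as the function [nth 0 e] makes an update of one variable a plain
    function update and lets environments be compared extensionally. *)
Definition term_fun g : Prop :=
  exists2 t : GRing.term R, GRing.rterm t &
    forall e : seq R, GRing.eval e t = g (nth 0 e).

Definition definable P : Prop :=
  exists2 f : ord.formula R, ord.rformula f &
    forall e : seq R, ord.holds e f <-> P (nth 0 e).

Lemma term_fun_var i : term_fun (fun v => v i).
Proof. by exists (GRing.Var _ i). Qed.

Lemma term_fun_cst c : term_fun (fun=> c).
Proof. by exists (GRing.Const c). Qed.

Lemma term_funD g h : term_fun g -> term_fun h -> term_fun (fun v => g v + h v).
Proof.
by move=> [s rs gE] [t rt hE]; exists (GRing.Add s t) => /= [|e]; rewrite ?rs// gE hE.
Qed.

Lemma term_funM g h : term_fun g -> term_fun h -> term_fun (fun v => g v * h v).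
Proof.
by move=> [s rs gE] [t rt hE]; exists (GRing.Mul s t) => /= [|e]; rewrite ?rs// gE hE.
Qed.

Lemma term_funN g : term_fun g -> term_fun (fun v => - g v).
Proof. by move=> [s rs gE]; exists (GRing.Opp s) => //= e; rewrite gE. Qed.

Lemma term_funX g m : term_fun g -> term_fun (fun v => g v ^+ m).
Proof. by move=> [s rs gE]; exists (GRing.Exp s m) => //= e; rewrite gE. Qed.

Lemma term_fun_sum (I : Type) (s : seq I) (G : I -> (nat -> R) -> R) :
  (forall i, term_fun (G i)) -> term_fun (fun v => \sum_(i <- s) G i v).
Proof.
move=> hG; elim: s => [|i s IHs].
  by under eq_fun do rewrite big_nil; exact: term_fun_cst.
by under eq_fun do rewrite big_cons; exact: term_funD.
Qed.

Lemma term_fun_prod (I : Type) (s : seq I) (G : I -> (nat -> R) -> R) :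
  (forall i, term_fun (G i)) -> term_fun (fun v => \prod_(i <- s) G i v).
Proof.
move=> hG; elim: s => [|i s IHs].
  by under eq_fun do rewrite big_nil; exact: term_fun_cst.
by under eq_fun do rewrite big_cons; exact: term_funM.
Qed.

(** The index map [s] places the indeterminates of [p] at arbitrary variables
    of the ambient formula. *)
Lemma term_fun_meval m (s : 'I_m -> nat) (p : mpoly m R) :
  term_fun (fun v => meval (fun i => v (s i)) p).
Proof.
under eq_fun do rewrite mevalE.
apply: term_fun_sum => u; apply: term_funM; first exact: term_fun_cst.
by apply: term_fun_prod => i; apply: term_funX; exact: term_fun_var.
Qed.

Lemma definable_eq g h : term_fun g -> term_fun h ->
  definable (fun v => g v = h v).
Proof.
move=> [s rs gE] [t rt hE].
by exists (ord.Equal s t) => [|e] /=; rewrite ?rs// gE hE.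
Qed.

Lemma definable_lt g h : term_fun g -> term_fun h ->
  definable (fun v => g v < h v).
Proof.
move=> [s rs gE] [t rt hE].
by exists (ord.Lt s t) => [|e] /=; rewrite ?rs// gE hE.
Qed.

Lemma definable_le g h : term_fun g -> term_fun h ->
  definable (fun v => g v <= h v).
Proof.
move=> [s rs gE] [t rt hE].
by exists (ord.Le s t) => [|e] /=; rewrite ?rs// gE hE.
Qed.

Lemma definable_bool (b : bool) : definable (fun=> b).
Proof. by exists (ord.Bool b). Qed.

Lemma definable_and P Q : definable P -> definable Q ->
  definable (fun v => P v /\ Q v).
Proof.
move=> [s rs PE] [t rt QE].
by exists (ord.And s t) => [|e] /=; rewrite ?rs// PE QE.
Qed.

Lemma definable_or P Q : definable P -> definable Q ->
  definable (fun v => P v \/ Q v).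
Proof.
move=> [s rs PE] [t rt QE].
by exists (ord.Or s t) => [|e] /=; rewrite ?rs// PE QE.
Qed.

Lemma definable_imply P Q : definable P -> definable Q ->
  definable (fun v => P v -> Q v).
Proof.
move=> [s rs PE] [t rt QE].
by exists (ord.Implies s t) => [|e] /=; rewrite ?rs// PE QE.
Qed.

Lemma definable_not P : definable P -> definable (fun v => ~ P v).
Proof. by move=> [s rs PE]; exists (ord.Not s) => [|e] /=; rewrite ?rs// PE. Qed.

(** Together with the connectives, this closure under projection is what
    makes quantifier elimination applicable to a predicate without ever writing
    its formula down. *)
Lemma definable_exists i P : definable P ->
  definable (fun v => exists c, P [eta v with i |-> c]).
Proof.
move=> [s rs PE]; exists (ord.Exists i s) => //= e.
have E c : nth 0 (set_nth 0 e i c) = [eta nth 0 e with i |-> c].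
  by apply/funext => j; rewrite nth_set_nth.
by split=> -[c hc]; exists c; move: hc; rewrite PE E.
Qed.

Lemma definable_ext P Q : (forall v, P v <-> Q v) -> definable P -> definable Q.
Proof. by move=> PQ [s rs PE]; exists s => // e; rewrite PE PQ. Qed.

Lemma definable_all (I : eqType) (s : seq I) (P : I -> (nat -> R) -> Prop) :
  (forall i, definable (P i)) -> definable (fun v => forall i, i \in s -> P i v).
Proof.
move=> hP; elim: s => [|i s IHs]; first exact: definable_ext (definable_bool true).
apply: definable_ext (definable_and (hP i) IHs) => v; split.
  by move=> [Pi Ps] j; rewrite inE => /predU1P[->//|/Ps].
by move=> H; split=> [|j js]; apply: H; rewrite inE ?eqxx ?js ?orbT.
Qed.

Lemma definable_has (I : eqType) (s : seq I) (P : I -> (nat -> R) -> Prop) :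
  (forall i, definable (P i)) -> definable (fun v => exists2 i, i \in s & P i v).
Proof.
move=> hP; elim: s => [|i s IHs].
  by apply: definable_ext (definable_bool false) => v; split=> [//|[]].
apply: definable_ext (definable_or (hP i) IHs) => v; split.
  by case=> [Pi|[j js Pj]]; [exists i|exists j]; rewrite // inE ?eqxx ?js ?orbT.
by case=> j; rewrite inE => /predU1P[->|js Pj]; [left|right; exists j].
Qed.

Lemma definable_semialgebraic m (A : set 'rV[R]_m) (s : 'I_m -> nat) :
  semialgebraic A -> definable (fun v => A (\row_i v (s i))).
Proof.
move=> [l ->] /=; apply: definable_has => b.
have ev (p : mpoly m R) (v : nat -> R) : peval p (\row_i v (s i)) = meval (fun i => v (s i)) p.
  by apply: meval_eq => i; rewrite mxE.
apply: definable_and; apply: definable_all => p; under eq_fun do rewrite ev.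
  by apply: definable_eq; [exact: term_fun_meval|exact: term_fun_cst].
by apply: definable_lt; [exact: term_fun_cst|exact: term_fun_meval].
Qed.

(** The stored vector is a function on [nat] rather than an ['rV[R]_n], so that
    the block can be quantified one variable at a time by induction on [n]. *)
Definition store k n (v : nat -> R) (x : nat -> R) : nat -> R :=
  fun i => if (k <= i < k + n)%N then x (i - k)%N else v i.

Lemma storeS k n v x : store k n.+1 v x = [eta store k n v x with (k + n)%N |-> x n].
Proof.
apply/funext => i; rewrite /store /= addnS ltnS.
have [->|ne] := eqVneq i (k + n)%N; first by rewrite leq_addr leqnn addKn.
by rewrite [(i <= _)%N]leq_eqVlt (negPf ne).
Qed.

Lemma store_ext k n v x y : (forall i, (i < n)%N -> x i = y i) ->
  store k n v x = store k n v y.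
Proof.
move=> xy; apply/funext => i; rewrite /store; case: ifP => // /andP[ki ikn].
by apply: xy; rewrite ltn_subLR.
Qed.

Lemma definable_exists_block k n P : definable P ->
  definable (fun v => exists x : nat -> R, P (store k n v x)).
Proof.
elim: n P => [|n IHn] P dP.
  apply: definable_ext dP => v.
  have E x : store k 0 v x = v.
    by apply/funext => i; rewrite /store addn0 leqNgt; case: ltnP.
  by split=> [Pv|[x]]; [exists v|]; rewrite E.
apply: definable_ext (IHn _ (definable_exists (k + n) dP)) => v; split.
  move=> [x [c Pc]]; exists [eta x with n |-> c].
  rewrite storeS /= eqxx (@store_ext _ _ _ _ x)// => i ltin.
  by rewrite /= (ltn_eqF ltin).
by move=> [x Px]; exists x, (x n); rewrite -storeS.
Qed.
End Definability.

(** * Quantifier elimination and definable sets of the plane *)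

Section PlaneSets.
Variable R : realType.
Implicit Types (p q : {poly {poly R}}) (x y z : R).

(** Variable 0 becomes the outer indeterminate and variable 1 the inner one;
    any further variable is evaluated at the default value [0]. *)
Lemma rterm_bipoly (t : GRing.term R) : GRing.rterm t ->
  exists p, forall x y, GRing.eval [:: x; y] t = p.[x%:P].[y].
Proof.
elim: t => //=.
- move=> [|[|i]] _.
  + by exists 'X => x y; rewrite hornerX hornerC.
  + by exists ('X%:P) => x y; rewrite hornerC hornerX.
  + by exists 0 => x y; rewrite !horner0 -[RHS](nth_nil 0 i).
- by move=> c _; exists c%:P%:P => x y; rewrite !hornerC.
- by move=> k _; exists k%:R%:P%:P => x y; rewrite !hornerC.
- move=> s IHs t IHt /andP[/IHs[p pE] /IHt[q qE]]; exists (p + q) => x y.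
  by rewrite pE qE !hornerD.
- by move=> s IHs /IHs[p pE]; exists (- p) => x y; rewrite pE !hornerN.
- move=> s IHs k /IHs[p pE]; exists (p *+ k) => x y.
  by rewrite pE !hornerMn.
- move=> s IHs t IHt /andP[/IHs[p pE] /IHt[q qE]]; exists (p * q) => x y.
  by rewrite pE qE !hornerM.
- move=> s IHs k /IHs[p pE]; exists (p ^+ k) => x y.
  by rewrite pE !horner_exp.
Qed.

Lemma near_sgr_horner (p : {poly R}) y : p.[y] != 0 ->
  \forall z \near y, Num.sg p.[z] = Num.sg p.[y].
Proof.
have cp : p.[z] @[z --> y] --> p.[y] by exact: continuous_horner.
case: ltgtP => // py0 _.
  by apply: filterS (cvgr_lt _ cp _ py0) => z pz0; rewrite !ltr0_sg.
by apply: filterS (cvgr_gt _ cp _ py0) => z pz0; rewrite !gtr0_sg.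
Qed.

(** Local constancy in the second variable off an algebraic curve [q = 0] of the
    plane.  Having a single [q <> 0] for all [x] is the finiteness property of
    semialgebraic sets from which every bound below is derived; a conjunction
    of conditions is accommodated by multiplying the curves. *)
Definition curvewise_constant (T : Type) (F : R -> R -> T) : Prop :=
  exists2 q, q != 0 & forall x y, q.[x%:P].[y] != 0 ->
    \forall z \near y, F x z = F x y.

Lemma eq_curvewise_constant (T : Type) (F G : R -> R -> T) :
  (forall x y, F x y = G x y) -> curvewise_constant F -> curvewise_constant G.
Proof.
by move=> FG [q q0 hq]; exists q => // x y /hq; apply: filterS => z; rewrite !FG.
Qed.

Lemma curvewise_constant_cst (T : Type) (a : T) :
  curvewise_constant (fun _ _ => a).
Proof. by exists 1 => [|x y _]; [exact: oner_neq0|exact: filterE]. Qed.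

Lemma curvewise_constant_comp (T U : Type) (h : T -> U) (F : R -> R -> T) :
  curvewise_constant F -> curvewise_constant (fun x y => h (F x y)).
Proof.
by move=> [q q0 hq]; exists q => // x y /hq; apply: filterS => z ->.
Qed.

Lemma curvewise_constant_pair (T U : Type) (F : R -> R -> T) (G : R -> R -> U) :
  curvewise_constant F -> curvewise_constant G ->
  curvewise_constant (fun x y => (F x y, G x y)).
Proof.
move=> [p p0 hp] [q q0 hq]; exists (p * q); first by rewrite mulf_neq0.
move=> x y; rewrite !hornerM mulf_eq0 negb_or => /andP[/hp np /hq nq].
by apply: filterS2 np nq => z -> ->.
Qed.

(** By continuity the curve can be [p = 0] itself, except when [p] is the zero
    polynomial, whose sign is constant anyway. *)
Lemma curvewise_constant_sgr p :
  curvewise_constant (fun x y => Num.sg p.[x%:P].[y]).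
Proof.
have [->|p0] := eqVneq p 0.
  by apply: eq_curvewise_constant (curvewise_constant_cst 0) => x y; rewrite !horner0 sgr0.
by exists p => // x y; exact: near_sgr_horner.
Qed.

Lemma curvewise_constant_qf (f : ord.formula R) :
  ord.qf_form f && ord.rformula f ->
  curvewise_constant (fun x y => ord.qf_eval [:: x; y] f).
Proof.
have atom (h : R -> bool) (s t : GRing.term R) : GRing.rterm s && GRing.rterm t ->
    curvewise_constant (fun x y =>
      h (Num.sg (GRing.eval [:: x; y] s - GRing.eval [:: x; y] t))).
  move=> /andP[/rterm_bipoly[p pE] /rterm_bipoly[q qE]].
  apply: eq_curvewise_constant
    (curvewise_constant_comp h (curvewise_constant_sgr (p - q))) => x y.
  by rewrite pE qE !hornerE.
have both (h : bool -> bool -> bool) (F G : R -> R -> bool) :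
    curvewise_constant F -> curvewise_constant G ->
    curvewise_constant (fun x y => h (F x y) (G x y)).
  move=> cF cG; pose hh (u : bool * bool) := h u.1 u.2.
  exact: (curvewise_constant_comp hh (curvewise_constant_pair cF cG)).
elim: f => //=.
- by move=> b _; exact: curvewise_constant_cst.
- move=> s t /(atom (fun c => c == 0)).
  by apply: eq_curvewise_constant => x y; rewrite sgr_eq0 subr_eq0.
- move=> s t /(atom (fun c => c < 0)).
  by apply: eq_curvewise_constant => x y; rewrite sgr_lt0 subr_lt0.
- move=> s t /(atom (fun c => c <= 0)).
  by apply: eq_curvewise_constant => x y; rewrite sgr_le0 subr_le0.
- by move=> f IHf g IHg; rewrite andbACA => /andP[/IHf ? /IHg ?]; exact: (both andb).
- by move=> f IHf g IHg; rewrite andbACA => /andP[/IHf ? /IHg ?]; exact: (both orb).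
- by move=> f IHf g IHg; rewrite andbACA => /andP[/IHf ? /IHg ?]; exact: (both implb).
- by move=> f IHf /IHf; exact: curvewise_constant_comp.
Qed.

Lemma quantifier_free_equiv (f : ord.formula R) : ord.rformula f ->
  exists2 g : ord.formula R, ord.qf_form g && ord.rformula g &
    forall e, ord.holds e f <-> ord.qf_eval e g.
Proof.
move=> rf; have wf := @qe_rcf.wf_QE_wproj R.
exists (ord.quantifier_elim (fun i bc => qe_rcf.qfr_to_formula (qe_rcf.wproj i bc)) f); first exact: (ord.quantifier_elim_wf wf rf).
by move=> e; apply: rwP; apply: (ord.quantifier_elim_rformP wf (@qe_rcf.valid_QE_wproj R)).
Qed.

Lemma definable_curvewise_constant (P : (nat -> R) -> Prop) : definable P ->
  curvewise_constant (fun x y => P (nth 0 [:: x; y])).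
Proof.
move=> [f /quantifier_free_equiv[g wg fg] fP].
apply: eq_curvewise_constant
  (curvewise_constant_comp is_true (curvewise_constant_qf wg)) => x y.
by apply/propext; rewrite -fP fg.
Qed.

(** A point of the plane off the curve has a vertical neighbourhood lying either
    inside the set or outside it, and a supremum of a slice has neither. *)
Lemma sup_definable_root (P : (nat -> R) -> Prop) : definable P ->
  exists2 q, q != 0 & forall x, has_sup [set y | P (nth 0 [:: x; y])] ->
    q.[x%:P].[sup [set y | P (nth 0 [:: x; y])]] = 0.
Proof.
move=> /definable_curvewise_constant[q q0 hq]; exists q => // x supP.
set E := [set _ | _] in supP *; apply/eqP/negP => /negP/hq/nbhs_ballP[e /= e0 he].
have [y Ey ylt] := sup_adherent e0 supP.
have yle : y <= sup E by exact: sup_upper_bound.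
have Es : P (nth 0 [:: x; sup E]).
  by rewrite -(he y) // /ball /= ger0_norm; lra.
have Ee : E (sup E + e / 2).
  rewrite /E /= he // /ball /=.
  by rewrite opprD addrA subrr sub0r normrN gtr0_norm; lra.
by have := sup_upper_bound supP Ee; lra.
Qed.
End PlaneSets.

(** * Zeros of a bivariate polynomial near zero and at infinity *)

Section RootBounds.
Variable R : realType.
Implicit Types (p q : {poly {poly R}}) (x y : R).

Lemma poly_bounded_unit (p : {poly R}) :
  exists2 M, 0 < M & forall y, 0 <= y <= 1 -> `|p.[y]| <= M.
Proof.
elim/poly_ind: p => [|p c [M M0 pM]]; first by exists 1 => // y _; rewrite horner0 normr0.
exists (M + `|c|) => [|y /andP[y0 y1]]; first by rewrite ltr_pwDl.
rewrite !hornerE (le_trans (ler_normD _ _))// lerD2r normrM (ger0_norm y0).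
by rewrite -[leRHS]mulr1 ler_pM ?pM ?y0.
Qed.

Lemma bipoly_bounded_unit p : exists2 M, 0 < M &
  forall x y, 0 <= x <= 1 -> 0 <= y <= 1 -> `|p.[x%:P].[y]| <= M.
Proof.
elim/poly_ind: p => [|p c [M M0 pM]].
  by exists 1 => // x y _ _; rewrite !horner0 normr0.
have [N N0 cN] := poly_bounded_unit c.
exists (M + N) => [|x y xI yI]; first by rewrite addr_gt0.
rewrite !hornerE (le_trans (ler_normD _ _))// lerD ?cN//.
move: (xI) => /andP[x0 x1]; rewrite normrM (ger0_norm x0).
by rewrite -[leRHS]mulr1 ler_pM ?pM.
Qed.

(** Write [q = p x^k] with [c(y) = p(0, y)] not the zero polynomial and
    [c = u y^m] with [u(0) = a <> 0].  If [p(x, y) = 0], then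
    [u(y) y^m = - x r(x, y)] with [r] bounded on the unit square, and
    [|u(y)| >= |a| / 2] for [y] small.  The exponent is [m + 1] rather than [m]
    in order to be positive, which costs nothing as [y <= 1]. *)
Lemma bipoly_root_near0 q : q != 0 ->
  exists m M d, [/\ 0 < M, 0 < d & forall x y, 0 < x <= 1 -> 0 < y <= d ->
    q.[x%:P].[y] = 0 -> y ^+ m.+1 <= M * x].
Proof.
move=> q0; have [k [p /implyP/(_ q0) p0 qE]] := multiplicity_XsubC q 0.
set c := p.[0]; have [r rE] : exists r, p - c%:P = r * ('X - 0%:P).
  by apply/factor_theorem; rewrite /root !hornerE subrr.
have c0 : c != 0 by [].
have [m [u /implyP/(_ c0) u0 cE]] := multiplicity_XsubC c 0.
set a := u.[0]; have [v vE] : exists v, u - a%:P = v * ('X - 0%:P).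
  by apply/factor_theorem; rewrite /root !hornerE subrr.
have a0 : 0 < `|a| by rewrite normr_gt0.
have [M M0 vM] := poly_bounded_unit v.
have [N N0 rN] := bipoly_bounded_unit r.
exists m, (2 * N / `|a|), (Num.min 1 (`|a| / (2 * M))); split.
- by rewrite divr_gt0// mulr_gt0.
- by rewrite lt_min ltr01 divr_gt0// mulr_gt0.
move=> x y /andP[x0 x1] /andP[y0]; rewrite le_min => /andP[y1 yd] qxy.
have y01 : 0 <= y <= 1 by rewrite ltW.
have x01 : 0 <= x <= 1 by rewrite ltW.
have {qE}pxy : p.[x%:P].[y] = 0.
  move: qxy; rewrite qE !hornerE => /eqP; rewrite mulf_eq0 => /orP[/eqP//|].
  by rewrite ?subr0 expf_eq0 (gt_eqF x0) andbF.
have {rE}pE : u.[y] * y ^+ m = - (r.[x%:P].[y] * x).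
  have : p = r * ('X - 0%:P) + c%:P by rewrite -rE subrK.
  move=> /(congr1 (fun f : {poly {poly R}} => f.[x%:P].[y])).
  rewrite pxy !hornerE cE !hornerE ?subr0.
  move=> /esym/eqP.
  by rewrite addrC addr_eq0 => /eqP.
have {vE}uy : `|a| / 2 <= `|u.[y]|.
  have -> : u.[y] = v.[y] * y + a.
    by have -> : u = v * ('X - 0%:P) + a%:P; [rewrite -vE subrK|rewrite !hornerE subr0].
  have := ler_normB (v.[y] * y + a) (v.[y] * y); rewrite addrAC subrr add0r.
  have : `|v.[y] * y| <= `|a| / 2.
    have -> : `|a| / 2 = M * (`|a| / (2 * M)) by field; rewrite gt_eqF.
    by rewrite normrM (gtr0_norm y0) ler_pM ?vM// ltW.
  by lra.
have {pE} : `|a| / 2 * y ^+ m <= N * x.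
  have ym0 : 0 <= y ^+ m by rewrite exprn_ge0// ltW.
  apply: le_trans (ler_wpM2r ym0 uy) _.
  rewrite -{1}(ger0_norm ym0) -normrM pE normrN normrM (gtr0_norm x0).
  by rewrite ler_wpM2r ?rN// ltW.
move=> H; rewrite (@le_trans _ _ (y ^+ m))//.
  by rewrite exprS ler_piMl// exprn_ge0// ltW.
rewrite mulrAC ler_pdivlMr//; move: H; lra.
Qed.

(** Stated for a sum because it is applied to the sum of the coefficients that
    occurs in the Cauchy bound. *)
Lemma poly_sum_growth (s : seq {poly R}) :
  exists C k, 0 < C /\ forall x, 1 <= x -> \sum_(p <- s) `|p.[x]| <= C * x ^+ k.
Proof.
have poly_growth (p : {poly R}) :
    exists C k, 0 < C /\ forall x, 1 <= x -> `|p.[x]| <= C * x ^+ k.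
  elim/poly_ind: p => [|p c [C [k [C0 pC]]]].
    by exists 1, 0%N; split=> // x _; rewrite horner0 normr0 expr0 mulr1.
  exists (C + `|c|), k.+1; split=> [|x x1]; first by rewrite ltr_pwDl.
  have x0 : 0 <= x by lra.
  rewrite !hornerE (le_trans (ler_normD _ _))// mulrDl lerD//.
    by rewrite normrM (ger0_norm x0) exprSr mulrA ler_wpM2r// pC.
  by rewrite ler_peMr// exprn_ege1.
elim: s => [|p s [C [k [C0 sC]]]].
  by exists 1, 0%N; split=> // x _; rewrite big_nil expr0 mulr1.
have [B [l [B0 pB]]] := poly_growth p.
exists (B + C), (l + k)%N; split=> [|x x1]; first by rewrite addr_gt0.
rewrite big_cons mulrDl lerD//.
  by rewrite (le_trans (pB _ x1))// ler_wpM2l ?(ltW B0)// ler_weXn2l ?leq_addr.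
by rewrite (le_trans (sC _ x1))// ler_wpM2l ?(ltW C0)// ler_weXn2l ?leq_addl.
Qed.

Lemma poly_bounded_away (p : {poly R}) : p != 0 ->
  exists2 T, 1 <= T & forall x, T <= x -> `|lead_coef p| <= `|p.[x]|.
Proof.
move=> p0.
have [T HT] : exists T, forall x, T <= x -> `|lead_coef p| <= `|p.[x]|.
  have [lp|lp] : 0 < lead_coef p \/ 0 < lead_coef (- p).
  - rewrite lead_coefN oppr_gt0; apply/orP.
    by rewrite orbC -neq_lt lead_coef_eq0.
  - have [T HT] := polyrcf.poly_pinfty_gt_lc lp; exists T => x /HT le.
    by rewrite (gtr0_norm lp) (le_trans le)// ler_norm.
  have [T HT] := polyrcf.poly_pinfty_gt_lc lp; exists T => x /HT le.
  by rewrite -normrN -lead_coefN (gtr0_norm lp) (le_trans le)// hornerN ler_normr lexx orbT.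
exists (Num.max 1 T) => [|x]; first by rewrite le_max lexx.
by rewrite ge_max => /andP[_]; exact: HT.
Qed.

(** This is the Cauchy bound for [q(x, y)] as a polynomial in [y], whose
    coefficients are those of [swapXY q] evaluated at [x].  For [x] large its
    leading coefficient is nonzero, so that the degree in [y] does not drop.
    The exponent is [k + 1] in order to be at least [1]. *)
Lemma bipoly_root_infty q : q != 0 ->
  exists k C T, [/\ 0 < C, 1 <= T & forall x y, T <= x -> q.[x%:P].[y] = 0 ->
    y <= C * x ^+ k.+1].
Proof.
move=> q0; pose s := swapXY q.
have s0 : s != 0 by rewrite swapXY_eq0.
have l0 : lead_coef s != 0 by rewrite lead_coef_eq0.
set l := lead_coef s in l0.
have [T T1 lT] := poly_bounded_away l0.
have a0 : 0 < `|lead_coef l| by rewrite normr_gt0 lead_coef_eq0.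
set a := `|lead_coef l| in lT a0.
have [C [k [C0 sC]]] := poly_sum_growth s.
exists k, (1 + a^-1 * C), T; split=> //.
  by rewrite addr_gt0// mulr_gt0// invr_gt0.
move=> x y xT qxy.
have x1 : 1 <= x by apply: le_trans xT.
have lx0 : l.[x] != 0 by rewrite -normr_gt0 (lt_le_trans a0)// lT.
have qE : q.[x%:P] = map_poly (horner_eval x) s by rewrite -horner_polyC.
have sz : size (map_poly (horner_eval x) s) = size s by rewrite size_poly_eq.
have lcE : lead_coef q.[x%:P] = l.[x].
  by rewrite qE lead_coefE sz coef_map_id0 // /horner_eval ?horner0.
have qx0 : q.[x%:P] != 0 by rewrite -lead_coef_eq0 lcE.
have := polyrcf.cauchy_boundP qx0 qxy.
rewrite /polyrcf.cauchy_bound lcE qE sz => yb.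
have x0 : 0 <= x by lra.
apply: (le_trans (ler_norm y)); apply: (le_trans (ltW yb)).
rewrite mulrDl mul1r lerD ?exprn_ege1//.
apply: (@le_trans _ _ (a^-1 * (C * x ^+ k))); last first.
  by rewrite -mulrA !ler_wpM2l ?invr_ge0 ?(ltW a0) ?(ltW C0)// ler_weXn2l.
apply: ler_pM; rewrite ?invr_ge0 ?sumr_ge0//.
  by rewrite lef_pV2 ?lT// posrE// normr_gt0.
apply: le_trans (sC _ x1); rewrite (big_nth 0) big_mkord ler_sum// => i _.
by rewrite coef_map_id0 // /horner_eval ?horner0.
Qed.
End RootBounds.

(** * Power bounds for definable sets of the plane *)

(** The heights of the slices are bounded through their suprema, which are
    zeros [y] of one polynomial.  For [x <= h] the bound
    [y^(m+1) <= M x] gives the exponent [a = 1 / (m + 1)]; it applies because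
    smallness of the slices puts their suprema below [d].  For [x >= T] the
    exponent is [b = k + 1].  For [h < x < T] the height is bounded by [B], and
    [x `^ a >= h `^ a] turns the constant into a multiple of [x `^ a]. *)
Lemma definable_powR_bound (R : realType) (P : (nat -> R) -> Prop) :
    definable P ->
    (forall T, exists B, forall x y, 0 < x <= T -> P (nth 0 [:: x; y]) -> y <= B) ->
    (forall e, 0 < e -> exists2 d, 0 < d &
       forall x y, 0 < x <= d -> P (nth 0 [:: x; y]) -> y <= e) ->
  exists C a b : R, [/\ 0 < C, 0 < a, a <= 1 & 1 <= b] /\
    forall x y, 0 < x -> P (nth 0 [:: x; y]) -> y <= C * (x `^ a + x `^ b).
Proof.
move=> /sup_definable_root[q q0 qsup] bounded small.
have [m [M [d [M0 d0 near0]]]] := bipoly_root_near0 q0.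
have [k [C [T [C0 T1 infty]]]] := bipoly_root_infty q0.
have [e e0 he] := small d d0; have [B hB] := bounded T.
set a : R := m.+1%:R^-1; set b : R := k.+1%:R; set h := Num.min 1 e.
have a0 : 0 < a by rewrite invr_gt0.
have h0 : 0 < h by rewrite lt_min ltr01.
have ha0 : 0 < h `^ a by exact: powR_gt0.
exists (M `^ a + `|B| / h `^ a + C), a, b; split.
  split=> //; last by rewrite ler1n.
    by rewrite ltr_wpDl// addr_ge0 ?powR_ge0// divr_ge0// ltW.
  by rewrite invf_le1 ?ltr0n// ler1n.
move=> x y x0 Pxy; set E := [set z | P (nth 0 [:: x; z])].
have supE : has_sup E.
  split; first by exists y.
  by have [Bx hBx] := bounded x; exists Bx => z; apply: hBx; rewrite x0 lexx.
have leE w : (forall z, P (nth 0 [:: x; z]) -> z <= w) -> sup E <= w.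
  by move=> hw; apply: ge_sup => //; exists y.
apply: (@le_trans _ _ (sup E)); first exact: sup_upper_bound.
set K := _ + C; set u := x `^ a; set v := x `^ b.
have u0 : 0 <= u by exact: powR_ge0.
have v0 : 0 <= v by exact: powR_ge0.
have Ma0 : 0 <= M `^ a by exact: powR_ge0.
have Bh0 : 0 <= `|B| / h `^ a by rewrite divr_ge0// ltW.
have enough c w : 0 <= c <= K -> 0 <= w <= u + v -> sup E <= c * w ->
    sup E <= K * (u + v).
  move=> /andP[c0 cK] /andP[w0 wuv] /le_trans; apply.
  by rewrite ler_pM.
have [s0|s0] := leP (sup E) 0.
  by apply: (enough 0 0); rewrite ?lexx ?mulr0 // /K; lra.
have root := qsup x supE.
have [xh|hx] := leP x h.
  move: xh; rewrite le_min => /andP[x1 xe].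
  have sd : sup E <= d by apply: leE => z; apply: he; rewrite x0.
  apply: (enough (M `^ a) u); [by rewrite /K; lra|lra|].
  have := near0 x (sup E); rewrite x0 s0 => /(_ x1 sd root) sM.
  rewrite /u -powRM ?(ltW M0) ?(ltW x0)//.
  rewrite -[leLHS](powRr1 (ltW s0)) -(@mulfV _ m.+1%:R) ?pnatr_eq0//.
  rewrite powRrM powR_mulrn ?(ltW s0)// ge0_ler_powR ?nnegrE ?exprn_ge0 ?(ltW a0) ?(ltW s0)//.
  by rewrite mulr_ge0 ?ltW.
have [Tx|xT] := leP T x.
  apply: (enough C v); [by rewrite /K; lra|lra|].
  by rewrite /v /b powR_mulrn ?(ltW x0)// infty.
apply: (enough (`|B| / h `^ a) u); [by rewrite /K; lra|lra|].
rewrite mulrAC ler_pdivlMr//; apply: ler_pM; rewrite ?(ltW s0) ?(ltW ha0)//.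
  by apply: leE => z Pz; rewrite (le_trans _ (ler_norm B))// (hB x)// x0 ltW.
by rewrite ge0_ler_powR ?nnegrE ?(ltW a0) ?(ltW x0) ?(ltW h0) ?(ltW hx).
Qed.

(** * The distance function and its joint range with the residual *)

Section Distance.
Variables (R : realType) (n : nat).
Implicit Types (x y : 'rV[R]_n) (X S : set 'rV[R]_n) (psi : 'rV[R]_n -> R).

Lemma enorm_ge0 x : 0 <= enorm x.
Proof. exact: sqrtr_ge0. Qed.

Lemma enorm0 : enorm (0 : 'rV[R]_n) = 0.
Proof.
by rewrite /enorm big1 ?sqrtr0// => i _; rewrite mxE expr0n.
Qed.

Lemma dist_le x y S : S y -> dist x S <= enorm (x - y).
Proof.
move=> Sy; apply: ge_inf; last by exists y.
by exists 0 => _ [z _ <-]; exact: enorm_ge0.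
Qed.

Lemma le_dist x S d : S !=set0 -> (forall y, S y -> d <= enorm (x - y)) ->
  d <= dist x S.
Proof.
move=> [y Sy] dS; apply: lb_le_inf; first by exists (enorm (x - y)), y.
by move=> _ [z Sz <-]; exact: dS.
Qed.

Lemma dist_ge0 x S : S !=set0 -> 0 <= dist x S.
Proof. by move=> S0; apply: le_dist => // y _; exact: enorm_ge0. Qed.

Lemma dist_eq0 x S : S x -> dist x S = 0.
Proof.
move=> Sx; apply/eqP; rewrite eq_le dist_ge0 ?andbT; last by exists x.
by rewrite (le_trans (dist_le x Sx))// subrr enorm0.
Qed.

Lemma definable_forall_block k m (P : (nat -> R) -> Prop) : definable P ->
  definable (fun v => forall x : nat -> R, P (store k m v x)).
Proof.
move=> /definable_not/(definable_exists_block k m)/definable_not.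
apply: definable_ext => v; split=> [nP x|P_ [x]]; last exact.
by apply: contrapT => nPx; apply: nP; exists x.
Qed.

(** Asking for [d <= enorm (x - y)] for all [y] in [S], instead of
    [d = dist x S], avoids expressing an infimum; the supremum of the slice at
    [t] still dominates [dist x S] for every [x] in [X] with [psi x = t]. *)
Lemma definable_residual_dist X S psi :
    semialgebraic X -> semialgebraic S -> semialgebraic_fun psi ->
  exists2 P, definable P & forall t d, P (nth 0 [:: t; d]) <->
    exists x, [/\ X x, psi x = t & forall y, S y -> d <= enorm (x - y)].
Proof.
move=> Xsa Ssa psisa.
(* Variables 0 and 1 hold t and d; x and y occupy the two blocks of n variables
   that follow.  The last coordinate of the graph is read from variable 0. *)
pose sx (i : 'I_n) := (2 + i)%N; pose sy (i : 'I_n) := (2 + n + i)%N.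
pose sg (i : 'I_(n + 1)) := if fintype.split i is inl j then sx j else 0%N.
(* The square root of [sq v] is the distance between the two stored vectors;
   comparing squares is only faithful for d > 0, hence the disjunction below. *)
pose sq v : R := \sum_(i < n) (v (sx i) - v (sy i)) ^+ 2.
have dfar : definable (fun v => S (\row_i v (sy i)) -> v 1%N <= 0 \/ v 1%N ^+ 2 <= sq v).
  apply: definable_imply; first exact: definable_semialgebraic.
  apply: definable_or; apply: definable_le; try exact: term_fun_cst.
  - exact: term_fun_var.
  - by apply: term_funX; exact: term_fun_var.
  apply: term_fun_sum => i; apply: term_funX.
  by apply: term_funD; [|apply: term_funN]; exact: term_fun_var.
have := definable_exists_block 2 n (definable_and (definable_semialgebraic sx Xsa)
  (definable_and (definable_semialgebraic sg psisa) (definable_forall_block (2 + n) n dfar))).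
set P := (X in definable X) => dP; exists P => // t d.
pose nf (x : 'rV[R]_n) (i : nat) : R := oapp (fun j => x 0 j) 0 (insub i).
have nfE x : \row_i nf x i = x.
  by apply/rowP => i; rewrite mxE /nf valK.
pose e := nth 0 [:: t; d].
have xi (x : nat -> R) (i : 'I_n) : store 2 n e x (sx i) = x i.
  by rewrite /store /sx leq_addr ltn_add2l ltn_ord addKn.
have xyi (x y : nat -> R) (i : 'I_n) : store (2 + n) n (store 2 n e x) y (sx i) = x i.
  by rewrite {1}/store /sx leqNgt ltn_add2l ltn_ord xi.
have yi (x y : nat -> R) (i : 'I_n) : store (2 + n) n (store 2 n e x) y (sy i) = y i.
  by rewrite /store /sy leq_addr ltn_add2l ltn_ord addKn.
have xE (x : nat -> R) : \row_i store 2 n e x (sx i) = \row_i x i.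
  by apply/rowP => i; rewrite !mxE xi.
have yE (x y : nat -> R) : \row_i store (2 + n) n (store 2 n e x) y (sy i) = \row_i y i.
  by apply/rowP => i; rewrite !mxE yi.
have gE (x : nat -> R) :
    graph psi (\row_i store 2 n e x (sg i)) <-> psi (\row_i x i) = t.
  have -> : \row_i store 2 n e x (sg i) = row_mx (\row_i x i) t%:M.
    apply/rowP => i; rewrite !mxE /sg; case: (fintype.split i) => j.
      by rewrite xi mxE.
    by rewrite mxE !ord1.
  split=> [[z _ /eq_row_mx[-> /rowP/(_ 0)]]|<-]; last by exists (\row_i x i).
  by rewrite !mxE !eqxx.
have sqE (x y : nat -> R) : Num.sqrt (sq (store (2 + n) n (store 2 n e x) y)) =
    enorm (\row_(i < n) x i - \row_i y i).
  rewrite /enorm /sq; congr Num.sqrt; apply: eq_bigr => i _.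
  by rewrite xyi yi !mxE.
have far (x y : nat -> R) : (d <= 0 \/ d ^+ 2 <= sq (store (2 + n) n (store 2 n e x) y)) <->
    d <= enorm (\row_(i < n) x i - \row_i y i).
  rewrite -sqE; set r := sq _.
  have r0 : 0 <= r by apply: sumr_ge0 => i _; exact: sqr_ge0.
  split=> [[d0|dr]|]; first by rewrite (le_trans d0)// sqrtr_ge0.
    by rewrite (le_trans (ler_norm d))// -sqrtr_sqr ler_sqrt.
  have [d0|d0] := leP d 0; [by left|right].
  by rewrite -(sqr_sqrtr r0) ler_sqr ?nnegrE ?sqrtr_ge0// ltW.
split=> [[x [Xx [gx Sx]]]|[x [Xx xt Sx]]].
  exists (\row_i x i); split; [by rewrite -xE|exact/gE|].
  move=> y Sy; rewrite -(nfE y); apply/far; apply: Sx.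
  by rewrite yE nfE.
exists (nf x); split; first by rewrite xE nfE.
split; first by apply/gE; rewrite nfE.
by move=> y; rewrite yE => /Sx; rewrite -{1}(nfE x) => /far.
Qed.
End Distance.

(** * The error bound *)

Section ErrorBound.
Variables (R : realType) (n : nat) (X S : set 'rV[R]_n) (psi : 'rV[R]_n -> R).

(** Otherwise some points of a sublevel set go to infinite distance from [S],
    while [psi] would have to tend to infinity along them. *)
Lemma dist_bounded_on_sublevel :
    (forall u : nat -> 'rV[R]_n, (forall k, X (u k)) ->
       dist (u k) S @[k --> \oo] --> +oo -> psi (u k) @[k --> \oo] --> +oo) ->
  forall T, exists B, forall x, X x -> psi x <= T -> dist x S <= B.
Proof.
move=> A2 T; apply: contrapT => /forallNP noB.
have /choice[u uP] (k : nat) : exists x, [/\ X x, psi x <= T & k%:R < dist x S].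
  have /existsNP[x /not_implyP[Xx /not_implyP[xT /negP]]] := noB k%:R.
  by rewrite -ltNge => kx; exists x.
have uoo : dist (u k) S @[k --> \oo] --> +oo.
  apply/cvgryPge => A; near=> k.
  have [_ _ /ltW] := uP k; apply: le_trans.
  by near: k; exact: nbhs_infty_ger.
have uX k : X (u k) by have [] := uP k.
have /cvgryPgt/(_ T) := A2 u uX uoo.
move=> [N _ /(_ N)] /(_ (leqnn N)) /=.
by have [_ uT _] := uP N; rewrite ltNge uT.
Unshelve. all: by end_near. Qed.

(** Uniform form of the sequential hypothesis, tested on a sequence along which
    [psi] is at most [1 / (k + 1)]. *)
Lemma dist_small_on_sublevel :
    (forall x, 0 <= psi x) ->
    (forall u : nat -> 'rV[R]_n, (forall k, X (u k)) ->
       psi (u k) @[k --> \oo] --> (0 : R) -> dist (u k) S @[k --> \oo] --> (0 : R)) ->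
  forall e, 0 < e -> exists2 d, 0 < d & forall x, X x -> psi x <= d -> dist x S <= e.
Proof.
move=> psi0 A1 e e0; apply: contrapT => /forall2NP nod.
have /choice[u uP] (k : nat) : exists x, [/\ X x, psi x <= k.+1%:R^-1 & e < dist x S].
  have [/negP|] := nod k.+1%:R^-1; first by rewrite invr_gt0 ltr0n.
  move=> /existsNP[x /not_implyP[Xx /not_implyP[xT /negP]]].
  by rewrite -ltNge => kx; exists x.
have u0 : psi (u k) @[k --> \oo] --> (0 : R).
  apply: (@squeeze_cvgr _ _ _ _ (fun=> 0) (fun k => k.+1%:R^-1)).
  - by near=> k; rewrite psi0; have [] := uP k.
  - exact: cvg_cst.
  - exact: cvg_harmonic.
have uX k : X (u k) by have [] := uP k.
have /cvgr_lt/(_ e e0) := A1 u uX u0.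
move=> [N _ /(_ N)] /(_ (leqnn N)) /=.
by have [_ _ uT] := uP N; rewrite ltNge ltW.
Unshelve. all: by end_near. Qed.

(** A Lojasiewicz inequality valid on the whole of [X]: the small exponent
    governs the neighbourhood of [S] and the large one the behaviour at
    infinity.  Points with [psi x = 0] lie in [S] and are treated apart, since
    the plane argument divides by powers of [t = psi x]. *)
Lemma residual_error_bound :
    S !=set0 -> semialgebraic X -> semialgebraic S ->
    residual S psi -> semialgebraic_fun psi ->
    (forall u : nat -> 'rV[R]_n, (forall k, X (u k)) ->
       psi (u k) @[k --> \oo] --> (0 : R) -> dist (u k) S @[k --> \oo] --> (0 : R)) ->
    (forall u : nat -> 'rV[R]_n, (forall k, X (u k)) ->
       dist (u k) S @[k --> \oo] --> +oo -> psi (u k) @[k --> \oo] --> +oo) ->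
  exists C a b : R, [/\ 0 < C, 0 < a, a <= 1 & 1 <= b] /\
    forall x, X x -> dist x S <= C * (psi x `^ a + psi x `^ b).
Proof.
move=> S0 Xsa Ssa [psi_ge0 psi0] psisa A1 A2.
have [P dP PE] := definable_residual_dist Xsa Ssa psisa.
have [||C [a [b [[C0 a0 a1 b1] HC]]]] := definable_powR_bound dP.
- move=> T; have [B hB] := dist_bounded_on_sublevel A2 T; exists B.
  move=> t d /andP[_ tT] /PE[x [Xx xt dS]].
  by rewrite (le_trans (le_dist S0 dS))// hB// xt.
- move=> e e0; have [r r0 hr] := dist_small_on_sublevel psi_ge0 A1 e0; exists r => //.
  move=> t d /andP[_ tr] /PE[x [Xx xt dS]].
  by rewrite (le_trans (le_dist S0 dS))// hr// xt.
exists C, a, b; split=> // x Xx.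
have [px|px] := leP (psi x) 0.
  rewrite dist_eq0; first by rewrite mulr_ge0 ?addr_ge0 ?powR_ge0// ltW.
  by apply/psi0/eqP; rewrite eq_le px psi_ge0.
by apply: HC => //; apply/PE; exists x; split=> // y; exact: dist_le.
Qed.
End ErrorBound.

(** * Exact penalization *)

Section ExactPenalty.
Variables (R : realType) (n : nat) (X S : set 'rV[R]_n) (f : 'rV[R]_n -> R).

(** Take the infimum over [y] in [S] of [f y <= f x + L * enorm (x - y)]. *)
Lemma inf_over_le_dist (L : R) : S !=set0 -> S `<=` X -> 0 < L ->
    (forall x x', X x -> X x' -> `|f x - f x'| <= L * enorm (x - x')) ->
    inf_over S f \is a fin_num ->
  forall x, X x -> fine (inf_over S f) <= f x + L * dist x S.
Proof.
move=> S0 SX L0 fL finS x Xx; rewrite -lerBlDl mulrC -ler_pdivrMr//.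
apply: le_dist => // y Sy; rewrite ler_pdivrMr// mulrC lerBlDl.
have infy : fine (inf_over S f) <= f y.
  by rewrite -lee_fin fineK//; apply: ereal_inf_lbound; exists y.
have := fL x y Xx (SX _ Sy); have := ler_norm (- (f x - f y)).
by rewrite normrN; lra.
Qed.

(** The strict inequality [L * C < c] leaves a margin [(c - L * C) * phi x]
    between [inf_S f] and the penalised value at [x].  Its nonnegativity gives
    the equality of infima, and its positivity off [S] prevents a minimizer over
    [X] from lying outside [S]. *)
Lemma exact_penalty (L C c : R) (phi : 'rV[R]_n -> R) :
    S !=set0 -> S `<=` X -> 0 < L ->
    (forall x x', X x -> X x' -> `|f x - f x'| <= L * enorm (x - x')) ->
    inf_over S f \is a fin_num ->
    (forall x, S x -> phi x = 0) -> (forall x, X x -> ~ S x -> 0 < phi x) ->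
    (forall x, X x -> dist x S <= C * phi x) -> L * C < c ->
  inf_over S f = inf_over X (fun x => f x + c * phi x) /\
  argmin S f = argmin X (fun x => f x + c * phi x).
Proof.
move=> S0 SX L0 fL finS phi0 phi_gt0 distC LCc; set F := fun x => _.
have FS x : S x -> F x = f x by move=> /phi0; rewrite /F => ->; rewrite mulr0 addr0.
have infF x : X x -> fine (inf_over S f) + (c - L * C) * phi x <= F x.
  move=> Xx; have := inf_over_le_dist S0 SX L0 fL finS Xx.
  by have := ler_wpM2l (ltW L0) (distC x Xx); rewrite /F; nra.
have infE : inf_over S f = inf_over X F.
  apply/eqP; rewrite eq_le; apply/andP; split.
    apply: le_ereal_inf_tmp => _ [x Xx <-]; rewrite -(fineK finS) lee_fin.
    apply: le_trans (infF x Xx); rewrite lerDl mulr_ge0 ?subr_ge0 ?(ltW LCc)//.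
    by have [/phi0->//|/(phi_gt0 x Xx)/ltW] := pselect (S x).
  apply: le_ereal_inf_tmp => _ [x Sx <-]; rewrite -FS//.
  by apply: ereal_inf_lbound; exists x => //; exact: SX.
split=> //; apply/seteqP; split=> x [].
  by move=> Sx fx; split; [exact: SX|rewrite FS// fx].
rewrite -infE => Xx Fx.
have Sx : S x.
  apply: contrapT => /(phi_gt0 x Xx) px; have := infF x Xx.
  by rewrite -Fx /= leNgt ltrDl mulr_gt0// subr_gt0.
by split=> //; rewrite -FS.
Qed.
End ExactPenalty.

Theorem theorem5p5 (R : realType) (n : nat) (X S : set 'rV[R]_n)
    (f0 : 'rV[R]_n -> R) (psi : 'rV[R]_n -> R)
    (X0 : X !=set0) (S0 : S !=set0) (SX : S `<=` X)
    (Xsa : semialgebraic X) (Ssa : semialgebraic S)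
    (f0lip : elipschitz_on X f0)
    (f0inf : inf_over S f0 \is a fin_num)
    (psires : residual S psi) (psisa : semialgebraic_fun psi)
    (A1 : forall u : nat -> 'rV[R]_n, (forall k, X (u k)) ->
       psi (u k) @[k --> \oo] --> (0 : R) ->
       dist (u k) S @[k --> \oo] --> (0 : R))
    (A2 : forall u : nat -> 'rV[R]_n, (forall k, X (u k)) ->
       dist (u k) S @[k --> \oo] --> +oo ->
       psi (u k) @[k --> \oo] --> +oo) :
  exists cstar alpha beta : R,
    [/\ 0 < cstar, 0 < alpha, 0 < beta, alpha <= 1 & 1 <= beta] /\
    forall c : R, cstar < c ->
      inf_over S f0 =
        inf_over X (fun x => f0 x + c * (psi x `^ alpha + psi x `^ beta)) /\
      argmin S f0 =
        argmin X (fun x => f0 x + c * (psi x `^ alpha + psi x `^ beta)).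
Proof.
have [L L0 f0L] := f0lip.
have [C [a [b [[C0 a0 a1 b1] distC]]]] :=
  residual_error_bound S0 Xsa Ssa psires psisa A1 A2.
have b0 : 0 < b by rewrite (lt_le_trans ltr01).
exists (L * C), a, b; split; first by split=> //; exact: mulr_gt0.
have [psi_ge0 psi0] := psires.
move=> c LCc; apply: (exact_penalty S0 SX L0 f0L f0inf _ _ distC LCc).
  by move=> x /psi0 ->; rewrite !powR0 ?addr0 ?gt_eqF.
move=> x _ nSx; have px : 0 < psi x.
  by rewrite lt0r psi_ge0 andbT; apply/eqP => /psi0.
by rewrite addr_gt0 ?powR_gt0.
Qed.
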